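(* For every integer $n\ge 0$ and all $x\in\mathbb{R}$, $$P_n(x)=e^{-\frac{n}{2}x^2}\,\mathfrak{D}^{(n)}\left[e^{\frac{x^2}{2}}\right](x),$$ where $\mathfrak{D}^{(n)}$ is the $n$-th nested derivative.
   Context: The polynomials $P_n(x)$, $n\ge 0$, are defined by $P_0(x)=1$ and $P_n(x)=P_{n-1}'(x)+n x P_{n-1}(x)$ for $n\ge 1$. For a smooth function $f$, the nested derivatives $\mathfrak{D}^{(n)}[f]$ are defined by $\mathfrak{D}^{(0)}[f](x)\equiv 1$ and $\mathfrak{D}^{(n)}[f](x)=\frac{d}{dx}\left\{f(x)\cdot\mathfrak{D}^{(n-1)}[f](x)\right\}$ for $n\ge 1$. Here $\mathfrak{D}^{(n)}[e^{x^2/2}]$ means $\mathfrak{D}^{(n)}[f]$ with $f(x)=e^{x^2/2}$. *)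

(* Defs.v *)
From HB Require Import structures.
From mathcomp Require Import all_boot all_order all_algebra.
From mathcomp Require Import all_classical all_reals all_analysis.
Import Order.TTheory GRing.Theory Num.Theory.
Import numFieldNormedType.Exports.

Set Implicit Arguments.
Unset Strict Implicit.
Unset Printing Implicit Defensive.

Local Open Scope ring_scope.

Fixpoint P (R : realType) (n : nat) : {poly R} :=
  match n with
  | 0%N => 1
  | m.+1 => (P R m)^`() + m.+1%:R *: ('X * P R m)
  end.

(* [derive1] is total: the definition is meaningful when every function being
   differentiated is derivable, in particular for smooth [f]. *)
Fixpoint nested_derivative (R : realType) (f : R -> R) (n : nat) : R -> R :=
  match n with
  | 0%N => fun=> 1
  | m.+1 => derive1 (fun x => f x * nested_derivative f m x)
  end.

(* Main.v *)
Require Import Defs.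
From HB Require Import structures.
From mathcomp Require Import all_boot all_order all_algebra.
From mathcomp Require Import all_classical all_reals all_analysis.
From mathcomp Require Import ring.
Import Order.TTheory GRing.Theory Num.Theory.
Import numFieldNormedType.Exports.
Local Open Scope ring_scope.

(** Induction on [n] on the equivalent form D_n = e^(n x^2/2) P_n, with D_n the nested derivative:
    multiplying by e^(x^2/2) raises the exponent to (n+1) x^2/2, and the product rule then yields
    that exponential times P_n' + (n+1) x P_n, which is P_(n+1). *)

Lemma is_derive_horner (R : realType) (p : {poly R}) (x : R) :
  is_derive x 1 (horner p) p^`().[x].
Proof.
rewrite derivE derive1E.
by apply: derivableP; exact: derivable_horner.
Qed.

Lemma nested_derivative_expR_sqr (R : realType) (n : nat) (x : R) :
  nested_derivative (fun t : R => expR (t ^+ 2 / 2)) n x =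
  expR (n%:R / 2 * x ^+ 2) * (P R n).[x].
Proof.
elim: n x => [|n IHn] x; first by rewrite /= !mul0r expR0 !hornerE.
(* The induction hypothesis is needed as an equality of functions, since it is used under
   [derive1]. *)
have fD : (fun t : R => expR (t ^+ 2 / 2) *
      nested_derivative (fun t : R => expR (t ^+ 2 / 2)) n t) =
    (fun t => expR (n.+1%:R / 2 * t ^+ 2) * (P R n).[t]).
  apply/funext => t; rewrite IHn mulrA -expRD.
  by congr (expR _ * _); rewrite -natr1; field.
rewrite [LHS]/= fD.
(* Kept in the context so that instance resolution for [is_derive] can differentiate the polynomial
   factor. *)
have Pd := is_derive_horner R (P R n) x.
rewrite derive1E; apply: derive_val; apply: is_derive_eq.
by rewrite !hornerE /GRing.scale /= -natr1; field.
Qed.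

Theorem proposition13 (R : realType) (n : nat) (x : R) :
  (P R n).[x] = expR (- (n%:R / 2) * x ^+ 2) *
    nested_derivative (fun t : R => expR (t ^+ 2 / 2)) n x.
Proof.
by rewrite nested_derivative_expR_sqr mulrA -expRD mulNr addNr expR0 mul1r.
Qed.
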